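(* Let $r\ge 3$ and let $T$ be a forest with $k+1$ vertices and maximum degree $\Delta$. Then for every $n$, $\mathrm{schex}_r(n,\mathcal{B}(T))\le k+(r-3)(k-1)+\Delta-1$, i.e., every $r$-uniform hypergraph containing no Berge copy of $T$ has strong chromatic number at most $k+(r-3)(k-1)+\Delta-1$.
   Context: For a graph $T$, a hypergraph $\mathcal{H}$ is a Berge-$T$ if there is a bijection $f:E(T)\to E(\mathcal{H})$ with $e\subseteq f(e)$ for every $e\in E(T)$; $\mathcal{B}(T)$ is the family of all Berge-$T$ hypergraphs, and a hypergraph is $\mathcal{B}(T)$-free if it contains no subhypergraph belonging to $\mathcal{B}(T)$. $\mathrm{schex}_r(n,\mathcal{B}(T))$ is the supremum of $\chi_s(\mathcal{H})$ over $\mathcal{B}(T)$-free $r$-uniform hypergraphs on $n$ vertices, where $\chi_s$ (strong chromatic number) is the minimum number of colors in a vertex coloring in which every hyperedge is rainbow. *)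

(* Defs.v *)
From mathcomp Require Import all_boot.
Set Implicit Arguments. Unset Strict Implicit. Unset Printing Implicit Defensive.

Section Graph.
Variables (T : finType) (e : rel T).

Definition edges : {set {set T}} := [set [set p.1; p.2] | p : T * T & e p.1 p.2].

Definition max_degree : nat := \max_(x : T) #|[set y | e x y]|.

(* ucycle is a cyclic e-path without repeated vertices; those with fewer than
   three vertices are not cycles of a simple graph. *)
Definition forest : Prop := forall c : seq T, 2 < size c -> ~ ucycle e c.

End Graph.

Section Hypergraph.
Variable V : finType.
Implicit Types H B : {set {set V}}.

Definition uniform (r : nat) H : bool := [forall E in H, #|E| == r].

Definition strong_colorable H (m : nat) : bool :=
  [exists c : {ffun V -> 'I_m}, [forall E in H, dinjectiveb c E]].

Lemma ex_strong_colorable H : exists m, strong_colorable H m.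
Proof.
exists #|V|; apply/existsP; exists [ffun x => enum_rank x].
apply/forall_inP => E _; apply/dinjectiveP => x y _ _.
by rewrite !ffunE => /enum_rank_inj.
Qed.

Definition strong_chromatic_number H : nat := ex_minn (ex_strong_colorable H).

(* The containment of E in f E is meant up to isomorphism: phi embeds in V the
   vertices of T that lie on an edge. As the condition only concerns edges, the
   isolated vertices of T are not required to have an image. *)
Definition is_berge (T : finType) (e : rel T) B : bool :=
  [exists phi : {ffun {x : T | x \in cover (edges e)} -> V},
   exists f : {ffun {set T} -> {set V}},
     [&& injectiveb phi,
         dinjectiveb f (edges e),
         f @: edges e == B
       & [forall E in edges e, phi @: [set x | val x \in E] \subset f E]]].

Definition berge_free (T : finType) (e : rel T) H : bool :=
  [forall B : {set {set V}}, (B \subset H) ==> ~~ is_berge e B].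

End Hypergraph.

(* The maximum over an empty family is 0. *)
Definition schex (r n : nat) (T : finType) (e : rel T) : nat :=
  \max_(H : {set {set 'I_n}} | uniform r H && berge_free e H)
     strong_chromatic_number H.

(* Main.v *)
Require Import Defs.
From mathcomp Require Import all_boot.
From mathcomp Require Import zify.

Set Implicit Arguments. Unset Strict Implicit. Unset Printing Implicit Defensive.

(** A strong colouring of [H] is a proper colouring of its 2-shadow.  If greedy
    colouring with [m = k + (r - 3)(k - 1) + Delta - 1] colours fails, then some
    vertex set [W] has minimum degree at least [m] in the shadow, and a Berge
    copy of the forest is embedded in [W] one vertex at a time, each new vertex
    [x] having at most one neighbour [p] among those already placed.  Around the
    image [v] of [p], at most [k - 1] shadow neighbours are occupied by placed
    vertices.  A used hyperedge through [v] contains at least three placed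
    vertices, hence spoils at most [r - 3] further neighbours, unless it
    represents an edge at [p]; it then spoils at most [r - 2], but there are at
    most [Delta - 1] of these since the edge [px] is not yet represented.  So
    fewer than [m] neighbours of [v] are unavailable. *)

(** * Greedy colouring and one-point extension of injections *)

Lemma leq_card_bigcup (I V : finType) (F : {set I}) (A : I -> {set V}) :
  #|\bigcup_(i in F) A i| <= \sum_(i in F) #|A i|.
Proof.
elim/big_rec2: _ => [|i n B _ leBn]; first by rewrite cards0.
by apply: leq_trans (leq_card_setU _ _) _; rewrite leq_add2l.
Qed.

(** Induction on the coloured set [U]: set aside a vertex [w] with fewer than [m] neighbours in [U],
    colour the rest, and give [w] a colour absent from its neighbours. Positivity of [m] supplies a
    colouring to start from when [U] is empty. *)
Lemma degenerate_colorable (V : finType) (g : rel V) (m : nat) :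
  symmetric g -> 0 < m ->
  (forall W : {set V}, W != set0 ->
     exists2 w, w \in W & #|[set y in W | g w y]| < m) ->
  exists c : V -> 'I_m, forall x y, x != y -> g x y -> c x != c y.
Proof.
move=> g_sym m_gt0 degen.
suff /(_ setT) [c cP] : forall U : {set V}, exists c : V -> 'I_m,
    {in U &, forall x y, x != y -> g x y -> c x != c y}.
  by exists c => x y; apply: cP.
move=> U; have [n] := ubnP #|U|; elim: n U => // n IHn U leUn.
have [->|U0] := eqVneq U set0.
  by exists (fun=> Ordinal m_gt0) => x y; rewrite inE.
have [w wU degw] := degen U U0.
have [|c cP] := IHn (U :\ w); first by rewrite (cardsD1 w) wU in leUn *; lia.
have [i iP] : exists i, i \notin c @: [set y in U | g w y].
  apply/existsP; rewrite -[[exists _, _]]negbK negb_exists; apply/negP => /forallP full.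
  have := leq_ltn_trans (leq_imset_card c (mem [set y in U | g w y])) degw.
  rewrite ltnNge -{1}[m]card_ord => /negP; apply; apply: subset_leq_card.
  by apply/subsetP => i _; move: (full i); rewrite negbK.
exists (fun y => if y == w then i else c y) => x y xU yU nxy gxy.
have [xw|nxw] := eqVneq x w; have [yw|nyw] := eqVneq y w.
- by rewrite xw yw eqxx in nxy.
- by apply: contraNneq iP => ->; apply: imset_f; rewrite inE yU -xw.
- rewrite eq_sym; apply: contraNneq iP => ->.
  by apply: imset_f; rewrite inE xU -yw g_sym.
- by apply: cP => //; rewrite !inE ?nxw ?nyw.
Qed.

Lemma extend_injection (T V : finType) (W : {set V}) (S : {set T})
    (phi : T -> V) (x : T) (w : V) :
  {in S &, injective phi} -> {in S, forall y, phi y \in W} ->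
  x \notin S -> w \notin phi @: S -> w \in W ->
  exists phi' : T -> V,
    [/\ {in S, phi' =1 phi}, phi' x = w, {in x |: S &, injective phi'}
      & {in x |: S, forall y, phi' y \in W}].
Proof.
move=> phiI phiW xS wNS wW; pose phi' y := if y == x then w else phi y.
have phi'S : {in S, phi' =1 phi}.
  by move=> y yS; rewrite /phi'; case: eqVneq => // yx; rewrite -yx yS in xS.
have phi'x : phi' x = w by rewrite /phi' eqxx.
have wNphiS y : y \in S -> phi y != w.
  by move=> yS; apply: contraNneq wNS => <-; apply: imset_f.
exists phi'; split=> //.
- move=> y z /setU1P [->|yS] /setU1P [->|zS] //; rewrite ?phi'x ?phi'S //.
  + by move=> E; have := wNphiS z zS; rewrite -E eqxx.
  + by move=> E; have := wNphiS y yS; rewrite E eqxx.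
  + exact: phiI.
- by move=> y /setU1P [->|yS]; rewrite ?phi'x ?phi'S //; apply: phiW.
Qed.

(** * Edges and leaves of forests *)

Section Forest.
Variables (T : finType) (e : rel T).
Hypotheses (e_sym : symmetric e) (e_irr : irreflexive e).

Definition edges_in (S : {set T}) : {set {set T}} :=
  [set E in edges e | E \subset S].

Lemma edges_inP (S : {set T}) (E : {set T}) :
  reflect (exists x y, [/\ x \in S, y \in S, e x y & E = [set x; y]])
          (E \in edges_in S).
Proof.
apply: (iffP idP) => [|[x [y [xS yS exy ->]]]]; rewrite inE.
  case/andP => /imsetP [[x y]]; rewrite inE /= => exy -> /subsetP sES.
  by exists x, y; split=> //; apply: sES; rewrite !inE eqxx ?orbT.
apply/andP; split; first by apply/imsetP; exists (x, y); rewrite ?inE.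
by apply/subsetP => z; rewrite !inE => /orP [] /eqP ->.
Qed.

Lemma edges_inT : edges_in setT = edges e.
Proof. by apply/setP => E; rewrite inE subsetT andbT. Qed.

Lemma edges_in0 : edges_in set0 = set0.
Proof.
by apply/setP => E; rewrite in_set0; apply/edges_inP => -[x [y []]]; rewrite inE.
Qed.

Lemma edges_inU1 (x : T) (S : {set T}) :
  edges_in (x |: S) =
  edges_in S :|: [set [set x; y] | y in [set y in S | e x y]].
Proof.
apply/setP => E; rewrite in_setU; apply/edges_inP/orP => [[a [b []]]|[]].
- rewrite !in_setU1 => /predU1P [->|aS] /predU1P [->|bS] eab ->.
  + by rewrite e_irr in eab.
  + by right; apply: imset_f; rewrite inE bS.
  + by right; rewrite setUC; apply: imset_f; rewrite inE aS e_sym.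
  + by left; apply/edges_inP; exists a, b.
- by case/edges_inP => a [b [aS bS eab ->]]; exists a, b; rewrite !in_setU1 aS bS !orbT.
- case/imsetP => y; rewrite inE => /andP [yS exy] ->.
  by exists x, y; rewrite !in_setU1 eqxx yS orbT.
Qed.

(** An edge at [p] inside [S] is determined by its other end, a neighbour of [p] different from [x].
    Leaving out the neighbour [x] saves one from the degree bound. *)
Lemma card_edges_at (D : nat) (p x : T) (S : {set T}) :
  max_degree e = D -> e p x -> x \notin S ->
  #|[set E in edges_in S | p \in E]| <= D - 1.
Proof.
move=> degT epx xS.
have sub : [set E in edges_in S | p \in E] \subset
    [set [set p; y] | y in [set y | e p y] :\ x].
  apply/subsetP => E; rewrite inE => /andP [/edges_inP [a [b [aS bS eab ->]]]].
  rewrite !inE => /orP [] /eqP pE; rewrite pE in epx *.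
    by apply: imset_f; rewrite !inE eab andbT; apply: contraNneq xS => <-.
  rewrite setUC; apply: imset_f; rewrite !inE e_sym eab andbT.
  by apply: contraNneq xS => <-.
apply: leq_trans (subset_leq_card sub) _; apply: leq_trans (leq_imset_card _ _) _.
have : #|[set y | e p y]| <= D.
  by rewrite -degT /max_degree (leq_bigmax (F := fun x => #|[set y | e x y]|)).
by rewrite (cardsD1 x) inE epx; lia.
Qed.

Hypothesis e_forest : forest e.

(* Otherwise a path in [S] could be prolonged at its head forever: of two
   neighbours of the head, one is not its successor, and it closes a cycle if it
   lies on the path. *)
Lemma forest_leaf (S : {set T}) :
  S != set0 -> exists2 x, x \in S & #|[set y in S | e x y]| <= 1.
Proof.
move=> S0; apply/exists_inP; apply: contraT; rewrite negb_exists_in => /forall_inP deg2.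
suff /(_ #|T|) [x [s [sz _ /card_uniqP us _]]] : forall n, exists x s,
    [/\ size s = n, path e x s, uniq (x :: s) & {subset x :: s <= S}].
  by have := max_card (mem (x :: s)); rewrite us /= sz ltnn.
elim=> [|n [x [s [sz ps us sS]]]].
  have [x xS] := set0Pn _ S0; exists x, [::]; split=> // y.
  by rewrite inE => /eqP ->.
have xS : x \in S by apply: sS; rewrite inE eqxx.
have [y yS [exy yh]] : exists2 y, y \in S & e x y /\ y != head x s.
  have : 0 < #|[set y in S | e x y] :\ head x s|.
    by have := deg2 x xS; rewrite -ltnNge (cardsD1 (head x s)); case: (_ \in _); lia.
  case/card_gt0P => y; rewrite !inE => /andP [yh /andP [yS exy]].
  by exists y.
have [ys|yNs] := boolP (y \in x :: s); last first.
  exists y, (x :: s); split; first by rewrite /= sz.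
  - by rewrite /= e_sym exy.
  - by rewrite cons_uniq yNs.
  - by move=> z; rewrite inE => /predU1P [->|/sS].
have {}ys : y \in s.
  by move: ys; rewrite inE => /predU1P [yx|//]; rewrite yx e_irr in exy.
case/splitPr: ys ps us yh {sz sS} => s1 s2 ps us yh.
case: (@e_forest (x :: rcons s1 y)).
  by case: s1 yh {ps us} => [|z s1] //=; rewrite ?eqxx // size_rcons.
move: ps us; rewrite -cat_rcons cat_path -cat_cons cat_uniq => /andP [ps _] /andP [us _].
by rewrite /ucycle /ucycleb us andbT /= rcons_path ps last_rcons e_sym.
Qed.

(** Stripping leaves one by one and reading the order backwards adds each vertex with at most one
    neighbour already present. *)
Lemma forest_ind (P : {set T} -> Prop) :
  P set0 ->
  (forall (x : T) (S : {set T}), x \notin S ->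
     #|[set y in S | e x y]| <= 1 -> P S -> P (x |: S)) ->
  forall S, P S.
Proof.
move=> P0 PU S; have [n] := ubnP #|S|; elim: n S => // n IHn S leSn.
have [->//|S0] := eqVneq S set0; have [x xS degx] := forest_leaf S0.
rewrite -(setD1K xS); apply: PU; first by rewrite !inE eqxx.
  apply: leq_trans degx; apply: subset_leq_card.
  by apply/subsetP => y; rewrite !inE => /andP [/andP [_ ->] ->].
by apply: IHn; rewrite (cardsD1 x) xS in leSn; lia.
Qed.

Lemma card_forest_edges (S : {set T}) : #|edges_in S| <= #|S| - 1.
Proof.
elim/forest_ind: S => [|x S xS degx IH]; first by rewrite edges_in0 cards0.
rewrite edges_inU1 cardsU1 xS.
apply: leq_trans (leq_card_setU _ _) _.
apply: leq_trans (leq_add IH (leq_imset_card _ _)) _.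
(* The first vertex adds no edge; this covers empty [S], where the truncated [#|S| - 1] is also
   0. *)
have : #|[set y in S | e x y]| <= #|S|.
  by apply: subset_leq_card; apply/subsetP => y; rewrite inE => /andP [].
by move: degx => /=; lia.
Qed.

End Forest.

(** * Berge embeddings into a set of large minimum shadow degree *)

Section Embedding.
Variables (V T : finType) (H : {set {set V}}) (e : rel T).

Definition shadow : rel V :=
  [rel x y | (x != y) && [exists E in H, (x \in E) && (y \in E)]].

Lemma shadow_sym : symmetric shadow.
Proof.
move=> x y; rewrite /shadow /= eq_sym; congr (_ && _).
by apply: eq_existsb => E; rewrite [(x \in E) && _]andbC.
Qed.

(** A partial Berge copy, on the subforest induced by [S]. Both maps are total, with irrelevant
    values off [S], so that an extension is an override at one point. *)
Definition berge_embedding (W : {set V}) (S : {set T})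
    (phi : T -> V) (f : {set T} -> {set V}) : Prop :=
  [/\ {in S &, injective phi}, {in S, forall x, phi x \in W},
      {in edges_in e S &, injective f}
    & {in edges_in e S, forall E, f E \in H /\ phi @: E \subset f E}].

Lemma berge_embedding_not_free W phi f :
  berge_embedding W setT phi f -> ~~ berge_free e H.
Proof.
rewrite /berge_embedding edges_inT => -[phiI _ fI fP].
apply/forallPn; exists (f @: edges e); rewrite negb_imply negbK.
apply/andP; split; first by apply/subsetP => _ /imsetP [E /fP [EH _] ->].
apply/existsP; exists [ffun x => phi (val x)].
apply/existsP; exists [ffun E => f E].
apply/and4P; split.
- apply/injectiveP => x y; rewrite !ffunE => /phiI xy.
  by apply/val_inj/xy; rewrite inE.
- by apply/dinjectiveP => E F EE FE; rewrite !ffunE; apply: fI.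
- by apply/eqP; apply: eq_imset => E; rewrite ffunE.
- apply/forall_inP => E EE; rewrite ffunE.
  have /subsetP sub := (fP E EE).2.
  apply/subsetP => _ /imsetP [x + ->]; rewrite inE ffunE => xE.
  by apply: sub; apply: imset_f.
Qed.

Variables (r k D : nat).
Hypotheses (hr : 3 <= r) (k_gt0 : 0 < k) (D_gt0 : 0 < D).
Hypotheses (e_sym : symmetric e) (e_irr : irreflexive e) (e_forest : forest e).
Hypotheses (cardT : #|T| = k.+1) (degT : max_degree e = D).
Hypothesis (H_unif : uniform r H).

Let m := k + (r - 3) * (k - 1) + D - 1.

Lemma card_notin_le (x : T) (S : {set T}) : x \notin S -> #|S| <= k.
Proof. by move=> xS; have := max_card [in x |: S]; rewrite cardT cardsU1 xS. Qed.

(** The hyperedge [f E] has [r] vertices and contains the image of [p |: E], which has three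
    elements if [p] is off [E] and two otherwise. *)
Lemma card_spoiled W S phi f p E :
  berge_embedding W S phi f -> p \in S -> E \in edges_in e S -> phi p \in f E ->
  #|f E :\: phi @: S| <= (r - 3) + (p \in E).
Proof.
move=> [phiI _ _ fP] pS EE vfE; have [fEH /subsetP sub] := fP E EE.
have cardE : #|p |: E| = 3 - (p \in E).
  have /edges_inP [a [b [_ _ eab ->]]] := EE.
  rewrite cardsU1 cards2; case: eqVneq eab => [->|_ _]; first by rewrite e_irr.
  by case: (_ \in _).
have sES : p |: E \subset S by rewrite subUset sub1set pS; case/setIdP: EE.
have sI : phi @: (p |: E) \subset f E :&: phi @: S.
  rewrite subsetI imsetS // andbT; apply/subsetP => _ /imsetP [y + ->].
  by case/setU1P => [->//|yE]; apply: sub; apply: imset_f.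
have := subset_leq_card sI; rewrite card_in_imset; last first.
  by apply: sub_in2 phiI; apply/subsetP.
have /eqP := forall_inP H_unif _ fEH.
by rewrite -(cardsID (phi @: S)) cardE; case: (_ \in _); lia.
Qed.

Lemma berge_embedding_extend (W : {set V}) (x p : T) (S : {set T}) phi f :
  {in W, forall w, m <= #|[set y in W | shadow w y]|} ->
  berge_embedding W S phi f -> x \notin S -> p \in S -> e x p ->
  [set y in S | e x y] = [set p] ->
  exists phi' f', berge_embedding W (x |: S) phi' f'.
Proof.
move=> degW emb xS pS exp nbrx; have [phiI phiW fI fP] := emb.
set v := phi p; set F := [set E in edges_in e S | v \in f E].
(* The vertex [v] itself can be left out of the occupied part, since it is not its own shadow
   neighbour; this gives [k - 1] rather than [k]. *)
pose spoiled := phi @: (S :\ p) :|: \bigcup_(E in F) (f E :\: phi @: S).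
have cardS := card_notin_le xS.
have card_spoiled_lt : #|spoiled| < m.
  apply: leq_ltn_trans (leq_card_setU _ _) _.
  have h1 : #|phi @: (S :\ p)| <= k - 1.
    apply: leq_trans (leq_imset_card _ _) _.
    by move: cardS; rewrite (cardsD1 p) pS; lia.
  have h2 : #|\bigcup_(E in F) (f E :\: phi @: S)| <= (r - 3) * (k - 1) + (D - 1).
    apply: leq_trans (_ : \sum_(E in F) ((r - 3) + (p \in E)) <= _).
      apply: leq_trans (leq_card_bigcup _ _) _.
      by apply: leq_sum => E; rewrite inE => /andP [EE vE]; apply: card_spoiled emb _ _ _.
    rewrite big_split /= sum_nat_const; apply: leq_add.
      rewrite mulnC leq_mul2l; apply/orP; right.
      apply: leq_trans (_ : #|edges_in e S| <= _).
        by apply: subset_leq_card; apply/subsetP => E; rewrite inE => /andP [].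
      by apply: leq_trans (card_forest_edges e_sym e_irr e_forest S) _; lia.
    (* The remaining sum counts edges at [p] inside [S], and [x] is a neighbour of [p] outside
       [S]. *)
    rewrite e_sym in exp; apply: leq_trans (card_edges_at e_sym degT exp xS).
    rewrite (_ : \sum_(E in F) _ = #|[set E in F | p \in E]|).
      apply: subset_leq_card; apply/subsetP => E.
      by rewrite !inE => /andP [/andP [-> _] ->].
    rewrite -sum1_card big_mkcond [RHS]big_mkcond; apply: eq_bigr => E _.
    by rewrite !inE; case: (E \in edges e) (E \subset S) (v \in f E) (p \in E) => [] [] [] [].
  (* The two bounds add up to [m - 1], as [k] and [D] are positive. *)
  by rewrite /m; lia.
have [w] : exists w, w \in [set y in W | shadow v y] :\: spoiled.
  apply/card_gt0P; have := degW v (phiW p pS).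
  rewrite -(cardsID spoiled) => h.
  have := subset_leq_card (subsetIr [set y in W | shadow v y] spoiled).
  by lia.
rewrite !inE negb_or => /andP [/andP [wNphi wNused] /andP [wW /andP [nvw]]].
case/exists_inP => h hH /andP [vh wh].
have wNS : w \notin phi @: S.
  apply: contra wNphi => /imsetP [y yS wy]; rewrite wy; apply: imset_f.
  by rewrite !inE yS andbT; apply: contraNneq nvw => yp; rewrite wy yp.
(* If [h] were already used, it would be a used hyperedge through [v], and its unoccupied vertex [w]
   would be spoiled. So [h] is free to represent the edge from [x] to [p]. *)
have hNused E : E \in edges_in e S -> f E != h.
  move=> EE; apply: contraNneq wNused => fEh; apply/bigcupP; exists E.
    by rewrite inE EE fEh.
  by rewrite inE wNS fEh.
have [phi' [phi'S phi'x phi'I phi'W]] := extend_injection phiI phiW xS wNS wW.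
pose f' E := if E == [set x; p] then h else f E.
have xpN : [set x; p] \notin edges_in e S.
  by apply: contra xS; rewrite inE subUset sub1set => /andP [_ /andP []].
have f'E E : E \in edges_in e S -> f' E = f E.
  by move=> EE; rewrite /f'; case: eqVneq => // Exp; rewrite Exp (negPf xpN) in EE.
have f'x : f' [set x; p] = h by rewrite /f' eqxx.
exists phi', f'; rewrite /berge_embedding edges_inU1 // nbrx imset_set1
  [edges_in _ _ :|: _]setUC.
split=> //.
- move=> A B /setU1P [->|AE] /setU1P [->|BE] //; rewrite ?f'x ?f'E //.
  + by move=> E; have := hNused B BE; rewrite -E eqxx.
  + by move=> E; have := hNused A AE; rewrite E eqxx.
  + exact: fI.
- move=> E /setU1P [->|EE].
    rewrite f'x; split=> //; rewrite imsetU1 imset_set1 phi'x phi'S //.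
    by rewrite subUset !sub1set wh.
  rewrite f'E //; have [fEH sub] := fP E EE; split=> //.
  apply: subset_trans sub; apply/subsetP => _ /imsetP [y yE ->].
  rewrite phi'S; first exact: imset_f.
  by move: EE; rewrite inE => /andP [_ /subsetP]; apply.
Qed.

Lemma exists_berge_embedding (W : {set V}) :
  W != set0 ->
  {in W, forall w, m <= #|[set y in W | shadow w y]|} ->
  forall S, exists phi f, berge_embedding W S phi f.
Proof.
move=> /set0Pn [w0 w0W] degW.
(* The vertex [w0] has at least [m >= k] shadow neighbours in [W], all different from [w0]. This
   leaves room for a vertex with no placed neighbour. *)
have cardW : k < #|W|.
  rewrite (cardsD1 w0) w0W ltnS.
  apply: leq_trans (_ : m <= _); first by rewrite /m; lia.
  apply: leq_trans (degW w0 w0W) _; apply: subset_leq_card.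
  by apply/subsetP => y; rewrite !inE eq_sym => /andP [-> /andP []] ->.
elim/(forest_ind e_sym e_irr e_forest) => [|x S xS degx [phi [f emb]]].
  exists (fun=> w0), (fun=> set0); rewrite /berge_embedding edges_in0.
  by split=> x; rewrite inE.
have [nbr0|[p]] := set_0Vmem [set y in S | e x y]; last first.
  move=> pn; move: (pn); rewrite inE => /andP [pS exp].
  apply: berge_embedding_extend emb xS pS exp _ => //; apply/esym/eqP.
  by rewrite eqEcard sub1set pn cards1.
have [phiI phiW fI fP] := emb.
(* With no neighbour in [S], the vertex [x] creates no new edge: any unoccupied vertex of [W] will
   do, and [f] is kept. *)
have [w] : exists w, w \in W :\: phi @: S.
  apply/card_gt0P; rewrite cardsD.
  rewrite subn_gt0; apply: leq_ltn_trans cardW.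
  apply: leq_trans (subset_leq_card (subsetIr _ _)) _.
  exact: leq_trans (leq_imset_card _ _) (card_notin_le xS).
rewrite inE => /andP [wNS wW].
have [phi' [phi'S phi'x phi'I phi'W]] := extend_injection phiI phiW xS wNS wW.
exists phi', f; rewrite /berge_embedding edges_inU1 // nbr0 imset0 setU0.
split=> // E EE; have [fEH sub] := fP E EE; split=> //.
apply: subset_trans sub; apply/subsetP => _ /imsetP [y yE ->].
rewrite phi'S; first exact: imset_f.
by move: EE; rewrite inE => /andP [_ /subsetP]; apply.
Qed.

Lemma berge_free_strong_colorable : berge_free e H -> strong_colorable H m.
Proof.
move=> free.
have [|W W0|c cP] := @degenerate_colorable V shadow m shadow_sym.
- by rewrite /m; lia.
- apply/exists_inP; apply: contraT; rewrite negb_exists_in => /forall_inP degW.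
  have {}degW : {in W, forall w, m <= #|[set y in W | shadow w y]|}.
    by move=> w /degW; rewrite -leqNgt.
  have [phi [f /berge_embedding_not_free]] := exists_berge_embedding W0 degW setT.
  by rewrite free.
apply/existsP; exists (finfun c); apply/forall_inP => E EH.
apply/dinjectiveP => x y xE yE; rewrite !ffunE => cxy.
apply/eqP; apply: contraT => nxy; have /(cP x y nxy) : shadow x y.
  by rewrite /shadow /= nxy; apply/exists_inP; exists E; rewrite ?xE.
by rewrite cxy eqxx.
Qed.

End Embedding.

(** * Edgeless forests and the final bound *)

(** If there were no edge, the empty hypergraph, contained in every [H], would be a Berge copy,
    because [is_berge] maps only vertices lying on an edge. *)
Lemma berge_free_edge (V T : finType) (e : rel T) (H : {set {set V}}) :
  berge_free e H -> exists x y, e x y.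
Proof.
move=> free; case: (pickP (fun p : T * T => e p.1 p.2)) => [[x y] exy|noe].
  by exists x, y.
have E0 : edges e = set0.
  rewrite -edges_inT; apply/setP => E; rewrite in_set0.
  by apply/edges_inP => -[x [y [_ _]]]; have /= -> := noe (x, y).
have dom0 : {x : T | x \in cover (edges e)} -> False.
  by case=> x; rewrite E0 /cover big_set0 inE.
suff B0 : is_berge e (set0 : {set {set V}}).
  by move/forallP/(_ set0): free; rewrite sub0set B0.
(* The domain is empty, so the map exists even when [V] has no element. *)
apply/existsP; exists [ffun x => False_rect V (dom0 x)]; apply/existsP; exists [ffun=> set0].
apply/and4P; split.
- by apply/injectiveP => x; case: (dom0 x).
- by apply/dinjectiveP => E; rewrite E0 inE.
- by rewrite E0 imset0.
- by apply/forall_inP => E EE; rewrite E0 inE in EE.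
Qed.

Theorem theorem1p5 (r k Delta : nat) (T : finType) (e : rel T)
    (hr : 3 <= r)
    (e_sym : symmetric e) (e_irr : irreflexive e) (e_forest : forest e)
    (cardT : #|T| = k.+1) (degT : max_degree e = Delta) :
  (forall n : nat, schex r n e <= k + (r - 3) * (k - 1) + Delta - 1) /\
  (forall (V : finType) (H : {set {set V}}),
     uniform r H -> berge_free e H ->
     strong_chromatic_number H <= k + (r - 3) * (k - 1) + Delta - 1).
Proof.
have bound (V : finType) (H : {set {set V}}) : uniform r H -> berge_free e H ->
    strong_chromatic_number H <= k + (r - 3) * (k - 1) + Delta - 1.
  move=> Hr free; have [x [y exy]] := berge_free_edge free.
  (* An edge makes both [Delta] and [k] positive, so the subtractions in the bound are not
     truncated. *)
  have Delta_gt0 : 0 < Delta.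
    rewrite -degT; apply: leq_trans (_ : #|[set y | e x y]| <= _).
      by apply/card_gt0P; exists y; rewrite inE.
    by rewrite /max_degree (leq_bigmax (F := fun x => #|[set y | e x y]|)).
  have k_gt0 : 0 < k.
    have := max_card [in [set x; y]]; rewrite cardT cards2.
    by case: eqVneq exy => [->|]; rewrite ?e_irr //; lia.
  rewrite /strong_chromatic_number; case: ex_minnP => m _; apply.
  exact: (berge_free_strong_colorable hr k_gt0 Delta_gt0 e_sym e_irr e_forest cardT degT Hr free).
by split=> // n; apply/bigmax_leqP => H /andP [Hr free]; apply: bound.
Qed.
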